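(* Let $(E_1,\mu_1)$ and $(E_2,\mu_2)$ be square-integrable vector measure spaces, and let $F_j=\mathrm{Lin}(E_j,\mu_j)\subset L^2(E_j,\mu_j)$, $j=1,2$, be their spaces of linear measurable functionals. The following conditions are equivalent: (i) $(E_1,\mu_1)$ and $(E_2,\mu_2)$ are linearly isomorphic mod $0$ (as vector measure spaces); (ii) there is a unitary multiplicative operator $U:L^2(E_1,\mu_1)\to L^2(E_2,\mu_2)$ with $U(F_1)=F_2$; (iii) there is a unitary operator $U:L^2(E_1,\mu_1)\to L^2(E_2,\mu_2)$ preserving the characteristic functionals, i.e. $\xi_{\mu_2}(Uf)=\xi_{\mu_1}(f)$ for all $f\in L^2(E_1,\mu_1)$, with $U(F_1)=F_2$. The corresponding isomorphism of vector measure spaces is exactly the isomorphism between $(E_1,\mu_1)$ and $(E_2,\mu_2)$: the isomorphism of measure spaces inducing $U$ is an isomorphism of vector measure spaces.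
   Context: All vector spaces are real. A vector measure space is a triple $(E,\mathcal A,\mu)$ (written $(E,\mu)$), where $E$ is a vector space with a fixed linear space of linear homomorphisms $E\to\mathbb R^n$, $n\in\mathbb N$, separating the points of $E$ (every nonzero point has a nonzero image under at least one of them), $\mathcal A$ is the $\sigma$-algebra generated by the inverse images of Borel sets of $\mathbb R^n$ under these homomorphisms, and $\mu$ is a probability measure on $\mathcal A$ such that $(E,\mathcal A,\mu)$ is isomorphic as a measure space to a Lebesgue--Rokhlin space. A morphism of vector measure spaces is a measure-preserving linear map defined on a vector subspace of full measure; morphisms are considered mod $0$. An isomorphism (linear isomorphism mod $0$) is an invertible morphism. A linear measurable functional on $(E,\mu)$ is a measurable real function $f$ (a class mod $0$) for which there is a vector subspace $E_f\subset E$ with $\mu(E_f)=1$ on which some individual function of the class is linear in the ordinary sense. $\mathrm{Lin}(E,\mu)$ is the space of all linear measurable functionals. The vector measure space is square-integrable if all its linear measurable functionals are square-integrable, i.e. $\mathrm{Lin}(E,\mu)\subset L^2(E,\mu)$. Here $L^2(E,\mu)$ is the real $L^2$ space; unitary means surjective, linear and isometric. A unitary operator $U:L^2(E_1,\mu_1)\to L^2(E_2,\mu_2)$ is multiplicative if it is induced by a measure-preserving isomorphism mod $0$ $T:(E_1,\mu_1)\to(E_2,\mu_2)$, i.e. $Uf=f\circ T^{-1}$. The characteristic functional is $\xi_\mu(f)=\int_E \exp(i f(x))\,d\mu(x)$ for real measurable $f$. *)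

(* Defs.v *)
From HB Require Import structures.
From mathcomp Require Import all_boot all_order all_algebra.
From mathcomp Require Import all_classical all_reals all_analysis.
From mathcomp Require Import measurable_realfun.
From mathcomp Require Import complex.

Set Implicit Arguments.
Unset Strict Implicit.
Unset Printing Implicit Defensive.

Import Order.TTheory GRing.Theory Num.Theory.
Import numFieldNormedType.Exports.

Local Open Scope classical_set_scope.
Local Open Scope ring_scope.

Section measure_spaces.
Context d1 d2 (R : realType) (T1 : measurableType d1) (T2 : measurableType d2).
Variables (mu1 : {measure set T1 -> \bar R}) (mu2 : {measure set T2 -> \bar R}).

(* Maps mod 0 are represented by total functions, which may be changed
   arbitrarily on negligible sets; accordingly preimages are only required to
   be measurable for the completion of mu1, whose value is given by the outer
   measure mu1^*. *)
Definition measure_preserving (T : T1 -> T2) :=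
  forall B, measurable B ->
    completed_algebra_gen mu1 (T @^-1` B) /\ (mu1^*)%mu (T @^-1` B) = mu2 B.

Definition inverse_mod0 (T : T1 -> T2) (S : T2 -> T1) :=
  {ae mu1, forall x, S (T x) = x} /\ {ae mu2, forall y, T (S y) = y}.

End measure_spaces.

Definition measure_isomorphism d1 d2 (R : realType)
    (T1 : measurableType d1) (T2 : measurableType d2)
    (mu1 : {measure set T1 -> \bar R}) (mu2 : {measure set T2 -> \bar R})
    (T : T1 -> T2) (S : T2 -> T1) :=
  [/\ measure_preserving mu1 mu2 T, measure_preserving mu2 mu1 S
    & inverse_mod0 mu1 mu2 T S].

(* Lebesgue measure on the interval [0, a] together with at most countably many
   atoms, the k-th one of mass c k. The atoms are realized as the points
   -1, -2, ... of the real line, outside the interval; the masses c k may be 0,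
   and the rest of the line is negligible. *)
Definition lebesgue_rokhlin_model (R : realType) (a : R) (c : {nonneg R}^nat) :
    {measure set (measurableTypeR R) -> \bar R} :=
  measure_add
    (mrestr (@lebesgue_measure R) (measurable_itv `[0, a]))
    (mseries (fun k => mscale (c k) (dirac (- k.+1%:R : measurableTypeR R))) 0).

Definition lebesgue_rokhlin d (R : realType) (T : measurableType d)
    (mu : {measure set T -> \bar R}) :=
  exists a c f g, measure_isomorphism mu (@lebesgue_rokhlin_model R a c) f g.

Section cylindrical.
Context (R : realType) (E : lmodType R) (H : forall n, set (E -> 'rV[R]_n)).

Definition cylinders : set (set E) :=
  \bigcup_n \bigcup_(h in @H n) preimage_set_system setT h <<s @open 'rV[R]_n >>.

(* E with the sigma-algebra generated by H, where H n is the given space of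
   homomorphisms E -> R^n; the spaces H n for different n need not be related.
   An alias of E is used because an lmodType is not canonically pointed. *)
Definition cylindrical : Type := let _ := H in E.

Lemma cylindrical0 : <<s cylinders >> set0.
Proof. by have [] := smallest_sigma_algebra [set: E] cylinders. Qed.

Lemma cylindricalC A : <<s cylinders >> A -> <<s cylinders >> (~` A).
Proof.
move=> mA; rewrite -setTD.
by have [_ + _] := smallest_sigma_algebra [set: E] cylinders; exact.
Qed.

Lemma cylindrical_bigcup (F : (set E)^nat) :
  (forall i, <<s cylinders >> (F i)) -> <<s cylinders >> (\bigcup_i F i).
Proof.
by move=> mF; have [_ _ +] := smallest_sigma_algebra [set: E] cylinders; exact.
Qed.

HB.instance Definition _ := GRing.Lmodule.on cylindrical.
HB.instance Definition _ := isPointed.Build cylindrical 0.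
HB.instance Definition _ := @isMeasurable.Build (sigma_display cylinders)
  cylindrical <<s cylinders >> cylindrical0 cylindricalC cylindrical_bigcup.

Definition vector_measure_space (mu : probability cylindrical R) :=
  [/\ forall n (h : E -> 'rV[R]_n), H h -> linear h,
      forall n, submod_closed (mem (@H n)),
      forall x : E, x != 0 -> exists n, exists2 h : E -> 'rV[R]_n, H h & h x != 0
    & lebesgue_rokhlin mu].

(* f coincides mod 0 with a function that is linear on a vector subspace of
   full measure; "full measure" refers to the completion of mu. *)
Definition linear_mod0 (F : lmodType R) (mu : probability cylindrical R)
    (f : cylindrical -> F) :=
  exists (V : set cylindrical) (g : cylindrical -> F),
    [/\ submod_closed (mem V), mu.-negligible (~` V),
        forall a x y, V x -> V y -> g (a *: x + y) = a *: g x + g y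
      & {ae mu, forall x, f x = g x}].

Definition Lin (mu : probability cylindrical R) :
    set {mfun_ mu, cylindrical >-> measurableTypeR R} :=
  [set f | linear_mod0 (F := R^o) mu f].

Arguments Lin : clear implicits.

Definition square_integrable (mu : probability cylindrical R) :=
  forall f, Lin mu f -> finite_norm mu 2 f.

Definition LinL2 (mu : probability cylindrical R) : set (LspaceType2 mu) :=
  [set f | Lin mu (LebesgueSpace.sort f)].

End cylindrical.
Arguments Lin {R E H} mu _.
Arguments LinL2 {R E H} mu _.

Section vector_morphisms.
Context (R : realType) (E1 E2 : lmodType R).
Context (H1 : forall n, set (E1 -> 'rV[R]_n)).
Context (H2 : forall n, set (E2 -> 'rV[R]_n)).
Variables (mu1 : probability (cylindrical H1) R).
Variables (mu2 : probability (cylindrical H2) R).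

Definition vector_isomorphism (T : cylindrical H1 -> cylindrical H2)
    (S : cylindrical H2 -> cylindrical H1) :=
  [/\ measure_preserving mu1 mu2 T /\ linear_mod0 mu1 T,
      measure_preserving mu2 mu1 S /\ linear_mod0 mu2 S
    & inverse_mod0 mu1 mu2 T S].

End vector_morphisms.

Definition expi (R : realType) (t : R) : R[i] := (cos t +i* sin t)%C.

Definition complex_integral d (R : realType) (T : measurableType d)
    (mu : {measure set T -> \bar R}) (g : T -> R[i]) : R[i] :=
  ((\int[mu]_x complex.Re (g x))%R +i* (\int[mu]_x complex.Im (g x))%R)%C.

Definition characteristic_functional d (R : realType) (T : measurableType d)
    (mu : {measure set T -> \bar R}) (f : T -> R) : R[i] :=
  complex_integral mu (fun x => expi (f x)).

Section operators.
Context d1 d2 (R : realType) (T1 : measurableType d1) (T2 : measurableType d2).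
Variables (mu1 : {measure set T1 -> \bar R}) (mu2 : {measure set T2 -> \bar R}).

Local Notation L2 mu := (LspaceType mu (lee1n 2)).
Implicit Type U : L2 mu1 -> L2 mu2.

(* The type of classes carries no module structure in the library: linearity is
   expressed by a.e. equality of representatives. *)
Definition unitary U :=
  [/\ forall (a : R) (f g h : L2 mu1),
        {ae mu1, forall x, h x = a * f x + g x} ->
        {ae mu2, forall y, U h y = a * U f y + U g y},
      forall f, ('N[mu2]_2 [EFin \o U f] = 'N[mu1]_2 [EFin \o f])%E
    & forall g, exists f, U f = g].

(* S plays the role of T^-1 in U f = f \o T^-1. *)
Definition induced_by U (T : T1 -> T2) (S : T2 -> T1) :=
  measure_isomorphism mu1 mu2 T S /\
  forall f, {ae mu2, forall y, U f y = f (S y)}.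

Definition multiplicative U := exists T S, induced_by U T S.

Definition preserves_characteristic_functional U :=
  forall f, characteristic_functional mu2 (U f) = characteristic_functional mu1 f.

End operators.

(* Main.v *)
Require Import Defs.
From HB Require Import structures.
From mathcomp Require Import all_boot all_order all_algebra.
From mathcomp Require Import all_classical all_reals all_analysis.
From mathcomp Require Import measurable_realfun.
From mathcomp Require Import complex ring lra.

(** The implications rest on two facts.

  A unitary operator U that preserves the characteristic functional is induced
  by a point isomorphism. If F is the indicator of A and Z = U F, then Z has
  the same square integral as F, and cos (2 pi Z) and sin (pi Z / 2) have the
  same integrals as for F. The first of these two forces Z to be integer
  valued; since n ^ 2 - sin (pi n / 2) is nonnegative on the integers and
  vanishes there only at 0 and 1, the function Z is again an indicator
  ([zero_one_valued]). By polarisation U preserves inner products, so that it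
  matches measurable sets up to null sets and keeps the measures of
  intersections: it is an isomorphism of the measure algebras
  ([indicator_measure_algebra_correspondence]). Between Lebesgue-Rokhlin spaces
  such an isomorphism comes from a point map: a real coordinate f, injective
  off a null set, is transported to the other space through its sublevel sets
  ([correspondence_function]), and the transported function followed by the
  inverse of f is the point map ([correspondence_realized]). The map S so
  obtained satisfies U F = F \o S because both sides have the same inner
  products with indicators ([realization_induces]). Conversely an operator
  induced by an isomorphism clearly preserves the characteristic functional.

  An isomorphism inducing such a U with U F_1 = F_2 is linear mod 0. A defining
  functional phi on E_2 is square-integrable, hence of the form U F with F in
  F_1, so phi \o T = F is linear mod 0 on E_1. To pass from the functionals phi
  \o T to T itself one needs countably many phi separating the points of E_2.
  They exist because the Rokhlin coordinate is measurable, hence depends on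
  countably many functionals, and injective off a null set, which depends on
  countably many as well; invariance under the common kernel of all of these
  then forces this kernel to be 0 ([countably_separated]). The countable family
  embeds E_2 linearly into a space of sequences, and T is linear on the full
  subspace on which the linear versions of the functions phi \o T take values
  in the image of this embedding ([linear_mod0_coordinates]).

  Finally, a linear isomorphism mod 0 induces a unitary operator by
  composition, and this carries F_1 onto F_2 because linearity mod 0 is stable
  under composition with it and with its inverse. *)

Set Implicit Arguments.
Unset Strict Implicit.
Unset Printing Implicit Defensive.

Import Order.TTheory GRing.Theory Num.Theory.
Import numFieldNormedType.Exports.
(* The algebra theory also has a constant called multiplicative. *)
Import Defs.

Local Open Scope classical_set_scope.
Local Open Scope ring_scope.

(** * Maps that preserve measure mod 0 *)

Section almost_everywhere_equal_sets.
Context d (R : realType) (T : measurableType d).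
Variable mu : {measure set T -> \bar R}.

Lemma ae_in_measurable (P : T -> Prop) : {ae mu, forall x, P x} ->
  exists N, [/\ measurable N, mu N = 0%E & forall x, ~ N x -> P x].
Proof.
move=> [N [mN N0 PN]]; exists N; split=> // x Nx; apply: contrapT => nPx.
exact/Nx/PN.
Qed.

Lemma ae_countable (I : countType) (P : I -> T -> Prop) :
  (forall i, {ae mu, forall x, P i x}) -> {ae mu, forall x, forall i, P i x}.
Proof.
move=> aeP.
have : {ae mu, forall x, forall n : nat,
    if unpickle n is Some i then P i x else True}.
  by apply: ae_foralln => n; case: unpickle => [i|]; [exact: aeP|exact: aeW].
by apply: filterS => x Px i; have := Px (pickle i); rewrite pickleK.
Qed.

Lemma ae_eq_measure (A B : set T) : measurable A -> measurable B ->
  {ae mu, forall x, A x <-> B x} -> mu A = mu B.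
Proof.
move=> mA mB /ae_in_measurable[N [mN N0 AB]].
suff le A' B' : measurable A' -> measurable B' ->
    (forall x, ~ N x -> A' x -> B' x) -> (mu A' <= mu B')%E.
  apply/eqP; rewrite eq_le.
  by rewrite !le// => x /AB[].
move=> mA' mB' AB'; rewrite -[leRHS]adde0 -N0.
apply: le_trans (measureU2 _ mB' mN); apply: le_measure; rewrite ?inE//.
  exact: measurableU.
by move=> x A'x; have [Nx|/AB' Bx] := pselect (N x); [right|left; exact: Bx].
Qed.

Lemma ae_not_in (N : set T) : measurable N -> mu N = 0%E ->
  {ae mu, forall x, ~ N x}.
Proof. by move=> mN N0; exists N; split=> // x /= /contrapT. Qed.

Lemma ae_not_in_measure0 (N : set T) : measurable N ->
  {ae mu, forall x, ~ N x} -> mu N = 0%E.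
Proof.
move=> mN aeN; rewrite (ae_eq_measure mN (@measurable0 _ T)) ?measure0//.
by apply: filterS aeN => x Nx; split.
Qed.

(** Sets of the completed algebra and their outer measures are handled through
  this characterization. *)
Lemma completed_algebra_ae (A : set T) : completed_algebra_gen mu A <->
  exists2 X, measurable X & {ae mu, forall x, A x <-> X x}.
Proof.
split=> [[X mX [N [M [mM M0 NM]] <-]]|[X mX [N [mN N0 AX]]]].
  exists X => //; apply: filterS (ae_not_in mM M0) => x Mx.
  by split=> [[//|/NM//]|]; left.
exists (X `\` N); first exact: measurableD.
exists (A `&` N).
  by exists N; split=> //; exact: subIsetr.
apply/seteqP; split=> [x [[Xx Nx]|[]//]|x Ax].
  by apply: contrapT => nAx; apply/Nx/AX => -[_ /(_ Xx)].
have [Nx|Nx] := pselect (N x); [by right|left; split=> //].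
by apply: contrapT => nXx; apply/Nx/AX => -[/(_ Ax)].
Qed.

Local Open Scope measure_scope.

Lemma outer_measure_ae (A X : set T) : measurable X ->
  {ae mu, forall x, A x <-> X x} -> mu^* A = mu X.
Proof.
move=> mX [N [mN N0 AX]]; apply/eqP; rewrite eq_le; apply/andP; split.
  rewrite -[leRHS]adde0 -N0 -(measurable_mu_extE mu mX).
  rewrite -(measurable_mu_extE mu mN).
  apply: le_trans (outer_measureU2 _ _ _); apply: le_mu_ext => x Ax.
  have [Nx|Nx] := pselect (N x); [by right|left].
  by apply: contrapT => nXx; apply/Nx/AX => -[/(_ Ax)].
have mXN : measurable (X `\` N) by exact: measurableD.
rewrite (_ : mu X = mu (X `\` N)); last first.
  apply: ae_eq_measure => //.
  by apply: filterS (ae_not_in mN N0) => x Nx; split=> [|[]].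
rewrite -(measurable_mu_extE mu mXN); apply: le_mu_ext => x [Xx Nx].
by apply: contrapT => nAx; apply/Nx/AX => -[_ /(_ Xx)].
Qed.

Local Close Scope measure_scope.

(** The rational rays determine a real function, and there are countably many of
  them: redefining f on the union of their exceptional null sets makes it
  measurable. *)
Lemma measurable_version (f : T -> R) :
  (forall t, completed_algebra_gen mu [set x | f x < t]) ->
  exists2 g : T -> R, measurable_fun setT g & {ae mu, forall x, f x = g x}.
Proof.
move=> cf.
have /choice[X XP] : forall q : rat, exists X, measurable X /\
    {ae mu, forall x, f x < ratr q <-> X x}.
  by move=> q; have /completed_algebra_ae[X] := cf (ratr q); exists X.
have [N [mN N0 fX]] := ae_in_measurable (ae_countable (fun q => (XP q).2)).
exists (fun x => if x \in N then 0 else f x); last first.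
  by apply: filterS (ae_not_in mN N0) => x Nx; rewrite memNset.
apply: (measurability _ (RGenInftyO.measurableE R)) => _ [_ [t ->] <-].
rewrite setTI.
rewrite (_ : _ @^-1` _ =
    (\bigcup_(q : rat) (if ratr q <= t then X q `\` N else set0)) `|`
    (if 0 < t then N else set0)).
  apply: measurableU; last by case: ifP.
  apply: bigcupT_measurable_rat => q; case: ifP => // _.
  by apply: measurableD => //; exact: (XP q).1.
apply/seteqP; split=> x /=; rewrite in_itv/=.
  case: ifPn => [/set_mem Nx t0|/negP Nx fxt]; first by right; rewrite t0.
  have {}Nx : ~ N x by move=> /mem_set.
  left; have [q /itvP qfx] := rat_in_itvoo fxt.
  exists q => //; rewrite qfx; split=> //; apply/fX => //.
  by rewrite qfx.
move=> [[q _]|].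
  case: ifPn => // qt [Xx Nx]; rewrite memNset//.
  by apply: lt_le_trans qt; exact/fX.
by case: ifPn => // t0 Nx; rewrite mem_set.
Qed.

End almost_everywhere_equal_sets.

Section measure_preserving_maps.
Context d1 d2 (R : realType) (T1 : measurableType d1) (T2 : measurableType d2).
Variables (mu1 : {measure set T1 -> \bar R}) (mu2 : {measure set T2 -> \bar R}).

Lemma measure_preservingP (T : T1 -> T2) :
  measure_preserving mu1 mu2 T <->
  forall B, measurable B -> exists X, [/\ measurable X, mu1 X = mu2 B &
    {ae mu1, forall x, B (T x) <-> X x}].
Proof.
split=> [mpT B mB|mpT B mB].
  have [/completed_algebra_ae[X mX BX] TB] := mpT _ mB.
  by exists X; split=> //; rewrite -TB (outer_measure_ae mX).
have [X [mX XB BX]] := mpT _ mB; split.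
  by apply/completed_algebra_ae; exists X.
by rewrite (outer_measure_ae mX).
Qed.

Lemma measure_preserving_ae (T : T1 -> T2) (P : T2 -> Prop) :
  measure_preserving mu1 mu2 T -> {ae mu2, forall y, P y} ->
  {ae mu1, forall x, P (T x)}.
Proof.
move=> /measure_preservingP mpT /ae_in_measurable[N [mN N0 NP]].
have [X [mX X0 NX]] := mpT _ mN; rewrite N0 in X0.
apply: filterS2 NX (ae_not_in mX X0) => x [NX _] Xx.
by apply: NP => /NX.
Qed.

Lemma measure_preserving_version (T : T1 -> T2) (f : T2 -> R) :
  measure_preserving mu1 mu2 T -> measurable_fun setT f ->
  exists2 g : T1 -> R, measurable_fun setT g & {ae mu1, forall x, f (T x) = g x}.
Proof.
move=> mpT mf; apply: measurable_version => t.
suff /mpT[] : measurable [set y | f y < t] by [].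
rewrite [X in measurable X](_ : _ = setT `&` f @^-1` `]-oo, t[).
  exact: mf.
by rewrite setTI; apply/seteqP; split=> y /=; rewrite in_itv.
Qed.

Lemma measure_preserving_law (T : T1 -> T2) (f : T2 -> R) (g : T1 -> R) B :
  measure_preserving mu1 mu2 T -> measurable_fun setT f ->
  measurable_fun setT g -> {ae mu1, forall x, f (T x) = g x} ->
  measurable B -> mu1 (g @^-1` B) = mu2 (f @^-1` B).
Proof.
move=> /measure_preservingP mpT mf mg fg mB.
have mgB : measurable (g @^-1` B).
  by rewrite -[X in measurable X]setTI; exact: mg.
have mfB : measurable (f @^-1` B).
  by rewrite -[X in measurable X]setTI; exact: mf.
have [X [mX <- BX]] := mpT _ mfB.
apply: ae_eq_measure => //; apply: filterS2 fg BX => x fgx.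
by rewrite /preimage/= fgx.
Qed.

(** The positive and the negative part of phi are treated separately, each by
  the change of variables for nonnegative functions. *)
Lemma same_law_integral (f : T1 -> R) (g : T2 -> R) (phi : R -> \bar R) :
  measurable_fun setT f -> measurable_fun setT g -> measurable_fun setT phi ->
  (forall B, measurable B -> mu1 (f @^-1` B) = mu2 (g @^-1` B)) ->
  (\int[mu1]_x phi (f x) = \int[mu2]_y phi (g y))%E.
Proof.
move=> mf mg mphi fg.
have ge0 (psi : R -> \bar R) : measurable_fun setT psi ->
    (forall t, 0 <= psi t)%E ->
    (\int[mu1]_x psi (f x) = \int[mu2]_y psi (g y))%E.
  move=> mpsi psi0.
  have := @ge0_integral_pushforward _ _ _ _ _ f mf mu1 setT psi measurableT mpsi
    (fun t _ => psi0 t).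
  have := @ge0_integral_pushforward _ _ _ _ _ g mg mu2 setT psi measurableT mpsi
    (fun t _ => psi0 t).
  rewrite !preimage_setT => <- <-; apply: eq_measure_integral => A mA _.
  exact: fg.
rewrite integralE [in RHS]integralE; congr (_ - _)%E.
  under eq_integral do rewrite funeposE -(funeposE phi).
  under [RHS]eq_integral do rewrite funeposE -(funeposE phi).
  by apply: (ge0 (phi^\+)%E) => //; exact: measurable_funepos.
under eq_integral do rewrite funenegE -(funenegE phi).
under [RHS]eq_integral do rewrite funenegE -(funenegE phi).
by apply: (ge0 (phi^\-)%E) => //; exact: measurable_funeneg.
Qed.

Lemma measure_preserving_integral (T : T1 -> T2) (f : T2 -> R) (g : T1 -> R)
    (phi : R -> R) :
  measure_preserving mu1 mu2 T -> measurable_fun setT f ->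
  measurable_fun setT g -> {ae mu1, forall x, f (T x) = g x} ->
  measurable_fun setT phi ->
  \int[mu1]_x phi (g x) = \int[mu2]_y phi (f y).
Proof.
move=> mpT mf mg fg mphi; congr fine.
apply: (@same_law_integral g f (EFin \o phi)) => //.
  exact/measurable_EFinP.
by move=> B mB; exact: (measure_preserving_law mpT mf mg fg mB).
Qed.

End measure_preserving_maps.

(** * Square-integrable classes and unitary operators *)

Section square_integrable_classes.
Context d (R : realType) (T : measurableType d).
Variable mu : {measure set T -> \bar R}.

Lemma Lnorm2E (f : T -> R) :
  ('N[mu]_2 [EFin \o f] = (\int[mu]_x (f x ^+ 2)%:E) `^ 2^-1)%E.
Proof.
rewrite unlock; congr (_ `^ _)%E; apply: eq_integral => x _ /=.
by rewrite powR_mulrn ?normr_ge0// -normrX ger0_norm ?sqr_ge0.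
Qed.

Lemma Lnorm2_sqr (f : T -> R) :
  ('N[mu]_2 [EFin \o f] `^ 2 = \int[mu]_x (f x ^+ 2)%:E)%E.
Proof.
rewrite Lnorm2E -poweRrM mulVf// poweRe1//.
by apply: integral_ge0 => x _; rewrite lee_fin sqr_ge0.
Qed.

Lemma finite_norm2P (f : T -> R) :
  finite_norm mu 2 f <-> (\int[mu]_x (f x ^+ 2)%:E < +oo)%E.
Proof.
rewrite -Lnorm2_sqr /finite_norm; split=> [/(poweR_lty 2)//|].
by apply: lty_poweRy; rewrite pnatr_eq0.
Qed.

Lemma class_measurable (F : LspaceType2 mu) : measurable_fun setT (F : T -> R).
Proof. exact: (@measurable_funPT _ _ _ _ (repr (LebesgueSpace.sort F))). Qed.

Lemma class_Lfun (F : LspaceType2 mu) : (F : T -> R) \in Lfun mu 2%:E.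
Proof.
by rewrite inE; apply/andP; split; rewrite inE/=;
  [exact: class_measurable|exact: Lebesgue_finite].
Qed.

(** Square-integrable classes are quotients, so that a.e. equality of
  representatives is equality. *)
Lemma class_ext (F G : LspaceType2 mu) : {ae mu, forall x, F x = G x} -> F = G.
Proof.
case: F G => [f [[fP]]] [g [[gP]]] /= fg.
have {fg}E : f = g.
  rewrite -[f]reprK -[g]reprK; apply/eqmodP/asboolP.
  by apply: filterS fg.
by subst g; rewrite (Prop_irrelevance fP gP).
Qed.

Lemma mfun_class_exists (f : T -> R) : measurable_fun setT f ->
  exists F : {mfun_ mu, T >-> measurableTypeR R},
    {ae mu, forall x, F x = f x}.
Proof.
move=> mf.
pose f' : {mfun T >-> measurableTypeR R} :=
  HB.pack f (@isMeasurableFun.Build _ _ T (measurableTypeR R) f mf).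
exists (\pi f')%qT.
have /eqmodP/asboolP : (repr (\pi f' : {mfun_ mu, T >-> measurableTypeR R}) = f'
    %[mod {mfun_ mu, T >-> measurableTypeR R}])%qT by rewrite reprK.
by apply: filterS => x /(_ I).
Qed.

Lemma ae_eq_finite_norm2 (f g : T -> R) : measurable_fun setT f ->
  measurable_fun setT g -> {ae mu, forall x, f x = g x} ->
  finite_norm mu 2 f -> finite_norm mu 2 g.
Proof.
move=> mf mg fg /finite_norm2P f2; apply/finite_norm2P.
rewrite (ae_eq_integral (fun x => (f x ^+ 2)%:E))//.
- by apply/measurable_EFinP; exact: measurable_funX.
- by apply/measurable_EFinP; exact: measurable_funX.
- by apply: filterS fg => x ->.
Qed.

Lemma class_of_mfun (f : {mfun_ mu, T >-> measurableTypeR R}) :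
  finite_norm mu 2 f -> exists F : LspaceType2 mu, LebesgueSpace.sort F = f.
Proof.
move=> f2.
pose F : LspaceType mu (lee1n 2) :=
  HB.pack f (@isFinLebesgue.Build _ T R mu 2%:E (lee1n 2) f f2).
by exists F.
Qed.

Lemma class_exists (f : T -> R) : measurable_fun setT f ->
  finite_norm mu 2 f ->
  exists F : LspaceType2 mu, {ae mu, forall x, F x = f x}.
Proof.
move=> mf f2; have [F Ff] := mfun_class_exists mf.
have [|G GF] := @class_of_mfun F.
  apply: ae_eq_finite_norm2 f2 => //.
    exact: (@measurable_funPT _ _ _ _ (repr F)).
  by apply: filterS Ff => x ->.
by exists G; rewrite GF.
Qed.

Lemma class_Lfun_exists (f : T -> R) : f \in Lfun mu 2%:E ->
  exists F : LspaceType2 mu, {ae mu, forall x, F x = f x}.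
Proof.
by rewrite inE => /andP[]; rewrite !inE/= => mf f2; exact: class_exists.
Qed.

Lemma class_lin (a : R) (F G : LspaceType2 mu) :
  exists H : LspaceType2 mu, {ae mu, forall x, H x = a * F x + G x}.
Proof.
apply: class_Lfun_exists.
have [_] := Lfun_submod_closed mu (lee1n 2).
by move/(_ a _ _ (class_Lfun F) (class_Lfun G)).
Qed.

Lemma class_sqr_integrable (F : LspaceType2 mu) :
  mu.-integrable setT (EFin \o (fun x => F x ^+ 2)).
Proof. exact/Lfun2_integrable_sqr/class_Lfun. Qed.

Lemma class_mul_integrable (F G : LspaceType2 mu) :
  mu.-integrable setT (EFin \o (fun x => F x * G x)).
Proof. by apply/Lfun1_integrable/Lfun2_mul_Lfun1; exact: class_Lfun. Qed.

Lemma Rintegral_sqr_lin (a : R) (F G H : LspaceType2 mu) :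
  {ae mu, forall x, H x = a * F x + G x} ->
  \int[mu]_x (H x ^+ 2) = a ^+ 2 * \int[mu]_x (F x ^+ 2) +
    2 * a * \int[mu]_x (F x * G x) + \int[mu]_x (G x ^+ 2).
Proof.
move=> HFG.
have iF := class_sqr_integrable F; have iG := class_sqr_integrable G.
have iFG := class_mul_integrable F G.
have iZ c (f : T -> R) : mu.-integrable setT (EFin \o f) ->
    mu.-integrable setT (EFin \o (fun x => c * f x)).
  by move=> fi; have := integrableZl measurableT c fi.
transitivity (\int[mu]_x ((a ^+ 2 * F x ^+ 2 + 2 * a * (F x * G x)) + G x ^+ 2)).
  congr fine; apply: ae_eq_integral => //.
  - exact/measurable_EFinP/measurable_funX/class_measurable.
  - apply/measurable_EFinP; apply: measurable_funD.
      apply: measurable_funD; apply: measurable_funM => //.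
        exact/measurable_funX/class_measurable.
      by apply: measurable_funM; exact: class_measurable.
    exact/measurable_funX/class_measurable.
  - by apply: filterS HFG => x -> _ /=; congr EFin; ring.
rewrite RintegralD//; last first.
  exact: (integrableD measurableT (iZ _ _ iF) (iZ (2 * a) _ iFG)).
rewrite RintegralD//; [|exact: iZ|exact: iZ].
by rewrite RintegralZl// RintegralZl.
Qed.

End square_integrable_classes.

Section unitary_operators.
Context d1 d2 (R : realType) (T1 : measurableType d1) (T2 : measurableType d2).
Variables (mu1 : {measure set T1 -> \bar R}) (mu2 : {measure set T2 -> \bar R}).
Variable U : LspaceType2 mu1 -> LspaceType2 mu2.
Hypothesis unitU : unitary U.

Lemma unitary_sqr F : \int[mu2]_y (U F y ^+ 2) = \int[mu1]_x (F x ^+ 2).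
Proof.
have [_ iso _] := unitU.
by rewrite /Rintegral -[X in fine X]Lnorm2_sqr iso Lnorm2_sqr.
Qed.

(** Polarisation. *)
Lemma unitary_inner F G :
  \int[mu2]_y (U F y * U G y) = \int[mu1]_x (F x * G x).
Proof.
have [lin _ _] := unitU.
have [H HFG] := class_lin 1 F G.
have := Rintegral_sqr_lin (lin _ _ _ _ HFG).
rewrite !unitary_sqr (Rintegral_sqr_lin HFG); lra.
Qed.

End unitary_operators.

(** * Recognizing indicators by trigonometric integrals *)

Section zero_one_valued_functions.
Variable R : realType.

(** If r is the fractional part of |z|, then cos (2 pi r) = 1 gives
  sin (pi r) = 0, whereas sin is positive on ]0, pi[. *)
Lemma cos_eq1_norm_nat (z : R) : cos (2 * pi * z) = 1 ->
  exists n : nat, `|z| = n%:R.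
Proof.
move=> cz; have {}cz : cos (2 * pi * `|z|) = 1.
  by case: (ger0P z) => _; rewrite ?mulrN ?cosN.
have [z0 nz] := (normr_ge0 z, truncn_itv (normr_ge0 z)).
exists (Num.truncn `|z|); apply/eqP; rewrite eq_sym -subr_eq0; apply/eqP.
move: nz; set n := Num.truncn _ => /andP[nz zn].
apply: contrapT => /eqP nz0.
pose r := `|z| - n%:R.
have r0 : 0 < r.
  by rewrite /r lt_neqAle subr_ge0 nz andbT -oppr_eq0 opprB eq_sym in nz0 *.
have r1 : r < 1 by rewrite /r ltrBlDr -natr1 addrC in zn *.
have : 0 < sin (pi * r).
  by apply: sin_gt0_pi; rewrite mulr_gt0 ?pi_gt0//= gtr_pMr ?pi_gt0.
have : cos (2 * pi * r) = 1.
  rewrite -[RHS]cz -[LHS](periodicn (@cosD2pi R) n); congr cos.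
  (* Stated for a variable p, so that the ring tactic does not unfold pi. *)
  have shift (p : R) : 2 * p * r + p *+ 2 *+ n = 2 * p * `|z|.
    by rewrite /r; ring.
  exact: shift.
rewrite -mulrA mulr_natl cos_mulr2n => cr.
have := sin2cos2 (pi * r); rewrite (_ : cos _ ^+ 2 = 1); last by lra.
by rewrite subrr => /eqP; rewrite sqrf_eq0 => /eqP ->; rewrite ltxx.
Qed.

Lemma sin_le_sqr_of_cos_eq1 (z : R) : cos (2 * pi * z) = 1 ->
  0 <= z ^+ 2 - sin (pi / 2 * z) /\
  (z ^+ 2 - sin (pi / 2 * z) = 0 -> z = 0 \/ z = 1).
Proof.
move=> /cos_eq1_norm_nat[n zn].
have z2 : z ^+ 2 = n%:R ^+ 2 by rewrite -zn -normrX ger0_norm ?sqr_ge0.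
have sin1 := sin_le1 (pi / 2 * z).
case: n => [|[|n]] in zn z2 *.
- have -> : z = 0 by apply/normr0_eq0.
  by rewrite mulr0 sin0 expr0n subr0; split=> // _; left.
- have [z0|z0] := leP 0 z.
    have -> : z = 1 by rewrite -(ger0_norm z0).
    by rewrite mulr1 sin_pihalf; split=> [|_]; [rewrite expr1n subrr|right].
  have -> : z = - 1 by rewrite -[z]opprK -(ltr0_norm z0) zn.
  rewrite mulrN1 sinN sin_pihalf; split; first lra.
  lra.
- have : 4 <= z ^+ 2.
    rewrite z2 (_ : 4 = 2%:R ^+ 2) ?lerXn2r ?nnegrE// ?ler_nat//.
    by rewrite -natrX.
  by split; lra.
Qed.

Lemma bounded_comp_integrable d (T : measurableType d) (mu : probability T R)
    (w : R -> R) (f : T -> R) : measurable_fun setT f ->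
  continuous w -> (forall t, `|w t| <= 1) ->
  mu.-integrable setT (EFin \o (fun x => w (f x))).
Proof.
move=> mf cw w1; apply: measurable_bounded_integrable => //.
- exact: le_lt_trans (probability_le1 mu measurableT) (ltry 1).
- by apply: measurableT_comp => //; exact: continuous_measurable_fun.
- exists 1; split=> // M M1 x _ /=; exact: le_trans (w1 _) (ltW M1).
Qed.

End zero_one_valued_functions.

Section zero_one_valued_integrals.
Context d (R : realType) (T : measurableType d).
Variable mu : {measure set T -> \bar R}.

Lemma ae_eq0_of_Rintegral (w : T -> R) :
  mu.-integrable setT (EFin \o w) -> {ae mu, forall x, 0 <= w x} ->
  \int[mu]_x w x = 0 -> {ae mu, forall x, w x = 0}.
Proof.
move=> iw w0 Iw.
have mw : measurable_fun setT (EFin \o w) by case/integrableP: iw.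
have I0 : (\int[mu]_x (w x)%:E = 0)%E.
  rewrite -[LHS]fineK; first by congr EFin.
  exact: integrable_fin_num.
have /(ae_eq_integral_abs mu measurableT mw) :
    (\int[mu]_x `|(EFin \o w) x| = 0)%E.
  rewrite -[RHS]I0; apply: ae_eq_integral => //.
    exact: measurableT_comp.
  by apply: filterS w0 => x wx _ /=; rewrite ger0_norm.
by apply: filterS => x /(_ I)[].
Qed.

End zero_one_valued_integrals.

Section zero_one_law.
Context d1 d2 (R : realType) (T1 : measurableType d1) (T2 : measurableType d2).
Variables (mu1 : probability T1 R) (mu2 : probability T2 R).

(** Both 1 - cos (2 pi f) and f ^ 2 - sin (pi f / 2) have the integral that the
  same expression has for g, which is 0. The first is nonnegative, hence
  vanishes a.e.; so f is integer valued and [sin_le_sqr_of_cos_eq1] applies to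
  the second. *)
Lemma zero_one_valued (f : T1 -> R) (g : T2 -> R) :
  measurable_fun setT f -> measurable_fun setT g ->
  mu1.-integrable setT (EFin \o (fun x => f x ^+ 2)) ->
  mu2.-integrable setT (EFin \o (fun x => g x ^+ 2)) ->
  \int[mu1]_x (f x ^+ 2) = \int[mu2]_y (g y ^+ 2) ->
  \int[mu1]_x cos (2 * pi * f x) = \int[mu2]_y cos (2 * pi * g y) ->
  \int[mu1]_x sin (pi / 2 * f x) = \int[mu2]_y sin (pi / 2 * g y) ->
  {ae mu2, forall y, g y = 0 \/ g y = 1} ->
  {ae mu1, forall x, f x = 0 \/ f x = 1}.
Proof.
move=> mf mg if2 ig2 fg2 fgc fgs g01.
have cosI d (T : measurableType d) (mu : probability T R) (h : T -> R) :
    measurable_fun setT h ->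
    mu.-integrable setT (EFin \o (fun x => cos (2 * pi * h x))).
  move=> mh; apply: (@bounded_comp_integrable _ _ _ _ (@cos R)) => //.
  - exact: measurable_funM.
  - exact: continuous_cos.
  - exact: cos_max.
have sinI d (T : measurableType d) (mu : probability T R) (h : T -> R) :
    measurable_fun setT h ->
    mu.-integrable setT (EFin \o (fun x => sin (pi / 2 * h x))).
  move=> mh; apply: (@bounded_comp_integrable _ _ _ _ (@sin R)) => //.
  - exact: measurable_funM.
  - exact: continuous_sin.
  - exact: sin_max.
have i1 d (T : measurableType d) (mu : probability T R) :
    mu.-integrable setT (EFin \o (fun=> 1 : R)).
  exact: finite_measure_integrable_cst.
have m1 d (T : measurableType d) (mu : probability T R) :
    \int[mu]_x 1 = 1 :> R.
  rewrite Rintegral_cst// mul1r.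
  exact: (congr1 fine (@probability_setT _ _ _ mu)).
have int0 d (T : measurableType d) (mu : probability T R) (w : T -> R) :
    measurable_fun setT w ->
    {ae mu, forall y, w y = 0} -> \int[mu]_y w y = 0.
  move=> mw w0; rewrite /Rintegral (ae_eq_integral (cst 0%E)) ?integral0//.
    exact/measurable_EFinP.
  by apply: filterS w0 => y ->.
have fcos : {ae mu1, forall x, cos (2 * pi * f x) = 1}.
  have : {ae mu1, forall x, 1 - cos (2 * pi * f x) = 0}.
    apply: ae_eq0_of_Rintegral.
    - exact: (integrableB measurableT (i1 _ _ _) (cosI _ _ _ _ mf)).
    - by apply: aeW => x; rewrite subr_ge0 cos_le1.
    - rewrite RintegralB//; [|exact: i1|exact: cosI].
      rewrite fgc m1 -[X in X - _](m1 _ _ mu2).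
      rewrite -RintegralB//; [|exact: i1|exact: cosI].
      apply: int0; first by have /integrableP[/measurable_EFinP] :=
        integrableB measurableT (i1 _ _ mu2) (cosI _ _ mu2 _ mg).
      apply: filterS g01 => y [->|->]; first by rewrite mulr0 cos0 subrr.
      by rewrite mulr1 mulr_natl cos2pi subrr.
  by apply: filterS => x /eqP; rewrite subr_eq0 eq_sym => /eqP.
have : {ae mu1, forall x, f x ^+ 2 - sin (pi / 2 * f x) = 0}.
  apply: ae_eq0_of_Rintegral.
  - exact: (integrableB measurableT if2 (sinI _ _ _ _ mf)).
  - by apply: filterS fcos => x /sin_le_sqr_of_cos_eq1[].
  - rewrite RintegralB//; [|exact: sinI].
    rewrite fgs fg2 -RintegralB//; [|exact: sinI].
    apply: int0; first by have /integrableP[/measurable_EFinP] :=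
      integrableB measurableT ig2 (sinI _ _ mu2 _ mg).
    apply: filterS g01 => y [->|->]; first by rewrite mulr0 sin0 expr0n subrr.
    by rewrite mulr1 sin_pihalf expr1n subrr.
by apply: filterS2 fcos => x /sin_le_sqr_of_cos_eq1[].
Qed.

End zero_one_law.

(** * Isomorphisms of measure algebras *)

Section measure_algebra_correspondences.
Context d1 d2 (R : realType) (T1 : measurableType d1) (T2 : measurableType d2).
Variables (mu1 : {measure set T1 -> \bar R}) (mu2 : {measure set T2 -> \bar R}).

(** An isomorphism of measure algebras, as a relation between representing
  sets. *)
Definition measure_algebra_correspondence (r : set T1 -> set T2 -> Prop) :=
  [/\ forall A B, r A B -> measurable A /\ measurable B,
      forall A, measurable A -> exists B, r A B,
      forall B, measurable B -> exists A, r A B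
    & forall A B A' B', r A B -> r A' B' -> mu1 (A `&` A') = mu2 (B `&` B')].

End measure_algebra_correspondences.

Lemma measure_algebra_correspondence_sym d1 d2 (R : realType)
    (T1 : measurableType d1) (T2 : measurableType d2)
    (mu1 : {measure set T1 -> \bar R}) (mu2 : {measure set T2 -> \bar R})
    (r : set T1 -> set T2 -> Prop) :
  measure_algebra_correspondence mu1 mu2 r ->
  measure_algebra_correspondence mu2 mu1 (fun B A => r A B).
Proof.
move=> [rm r1 r2 rI]; split=> //.
  by move=> A B /rm[].
by move=> A B A' B' rBA rBA'; rewrite (rI _ _ _ _ rBA rBA').
Qed.

Section measure_algebra_correspondence_theory.
Context d1 d2 (R : realType) (T1 : measurableType d1) (T2 : measurableType d2).
Variables (mu1 : {measure set T1 -> \bar R}) (mu2 : {measure set T2 -> \bar R}).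
Variable r : set T1 -> set T2 -> Prop.
Hypothesis rP : measure_algebra_correspondence mu1 mu2 r.

Lemma correspondence_measure A B : r A B -> mu1 A = mu2 B.
Proof.
have [_ _ _ rI] := rP => rAB.
by rewrite -[A]setIid -[B]setIid; exact: rI.
Qed.

(** Since every set Q of T2 corresponds to some P, facts about null sets of T2
  can be checked in T1; this is how the Boolean operations are transported
  below. *)
Lemma ae_not_in_by_correspondence Q : measurable Q ->
  (forall P, r P Q -> {ae mu1, forall x, ~ P x}) -> {ae mu2, forall y, ~ Q y}.
Proof.
have [rm _ r2 _] := rP => mQ PQ; have [P rPQ] := r2 _ mQ.
apply: ae_not_in => //; rewrite -(correspondence_measure rPQ).
by apply: ae_not_in_measure0; [have [] := rm _ _ rPQ|exact: PQ].
Qed.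

Lemma correspondence_disjoint A B P Q : r A B -> r P Q ->
  (forall y, Q y -> ~ B y) -> {ae mu1, forall x, P x -> ~ A x}.
Proof.
have [rm _ _ rI] := rP => rAB rPQ QB.
have [[mA _] [mP _]] := (rm _ _ rAB, rm _ _ rPQ).
have : mu1 (P `&` A) = 0%E.
  rewrite (rI _ _ _ _ rPQ rAB) (_ : Q `&` B = set0) ?measure0//.
  by apply/seteqP; split=> // y [/QB].
move/(ae_not_in (measurableI _ _ mP mA)).
by apply: filterS => x PAx Px Ax; exact: PAx.
Qed.

Lemma correspondence_sub A B P Q : r A B -> r P Q ->
  (forall y, Q y -> B y) -> {ae mu1, forall x, P x -> A x}.
Proof.
have [rm r1 r2 rI] := rP => rAB rPQ QB.
have [[mA mB] [mP mQ]] := (rm _ _ rAB, rm _ _ rPQ).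
have [C rAC] := r1 _ (measurableC mA).
have BC : {ae mu2, forall y, C y -> ~ B y}.
  have [_ mC] := rm _ _ rAC.
  have : mu2 (C `&` B) = 0%E.
    by rewrite -(rI _ _ _ _ rAC rAB) setICl measure0.
  move/(ae_not_in (measurableI _ _ mC mB)).
  by apply: filterS => x h Cx Bx; exact: h.
have [_ mC] := rm _ _ rAC.
have : mu1 (P `&` ~` A) = 0%E.
  rewrite (rI _ _ _ _ rPQ rAC).
  apply: ae_not_in_measure0; first exact: measurableI.
  by apply: filterS BC => y h [/QB By /h]; apply.
move/(ae_not_in (measurableI _ _ mP (measurableC mA))).
by apply: filterS => x h Px; apply: contrapT => nA; exact: h.
Qed.

Lemma correspondence_setC A B C : r A B -> r (~` A) C ->
  {ae mu2, forall y, C y <-> ~ B y}.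
Proof.
have [rm r1 r2 rI] := rP => rAB rAC.
have [[mA mB] [_ mC]] := (rm _ _ rAB, rm _ _ rAC).
have BC : {ae mu2, forall y, ~ (B `&` C) y}.
  apply: ae_not_in; first exact: measurableI.
  by rewrite -(rI _ _ _ _ rAB rAC) setICr measure0.
have : {ae mu2, forall y, ~ (~` (B `|` C)) y}.
  apply: ae_not_in_by_correspondence.
    by apply: measurableC; exact: measurableU.
  move=> P rPQ.
  have PA := correspondence_disjoint rAB rPQ (fun y h By => h (or_introl By)).
  have PA' := correspondence_disjoint rAC rPQ (fun y h Cy => h (or_intror Cy)).
  by apply: filterS2 PA PA' => x PA PA' Px; exact: (PA' Px (PA Px)).
apply: filterS2 BC => y BC nBC; split=> [Cy By|nBy]; first exact: BC.
by apply: contrapT => nCy; apply: nBC => -[].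
Qed.

(** C contains every B i. A set Q in the rest of C corresponds to a set P
  contained in the union of the A i and disjoint from each of them. *)
Lemma correspondence_bigcup (I : countType) (A : I -> set T1) B C :
  (forall i, r (A i) (B i)) -> r (\bigcup_i A i) C ->
  {ae mu2, forall y, C y <-> exists i, B i y}.
Proof.
have [rm r1 r2 rI] := rP => rAB rAC.
have mB i : measurable (B i) by have [] := rm _ _ (rAB i).
have [mA mC] := rm _ _ rAC.
have mUB : measurable (\bigcup_i B i).
  rewrite (_ : \bigcup_i _ =
      \bigcup_n (if @unpickle I n is Some i then B i else set0)).
    by apply: bigcupT_measurable => n; case: unpickle.
  apply/seteqP; split=> [y [i _ Biy]|y [n _]].
    by exists (pickle i) => //; rewrite pickleK.
  by case: unpickle => // i Biy; exists i.
have BC : {ae mu2, forall y, forall i, B i y -> C y}.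
  apply: ae_countable => i.
  apply: filterS (_ : {ae mu2, forall y, ~ (B i `\` C) y}).
    by move=> y h Biy; apply: contrapT => nCy; exact: h.
  apply: ae_not_in_by_correspondence; first exact: measurableD.
  move=> P rPQ.
  have PA := correspondence_sub (rAB i) rPQ (fun y h => h.1).
  have PC := correspondence_disjoint rAC rPQ (fun y h => h.2).
  apply: filterS2 PA PC => x PA PC Px; apply: (PC Px).
  by exists i => //; exact: PA.
have CB : {ae mu2, forall y, ~ (C `\` \bigcup_i B i) y}.
  apply: ae_not_in_by_correspondence; first exact: measurableD.
  move=> P rPQ.
  have PC := correspondence_sub rAC rPQ (fun y h => h.1).
  have PA : {ae mu1, forall x, forall i, P x -> ~ A i x}.
    apply: ae_countable => i; apply: correspondence_disjoint (rAB i) rPQ _.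
    by move=> y [_ nBy] Biy; apply: nBy; exists i.
  by apply: filterS2 PC PA => x PC PA Px; have [i _] := PC Px; exact: PA.
apply: filterS2 BC CB => y BC CB; split=> [Cy|[i Biy]]; last exact: BC Biy.
by apply: contrapT => nB; apply: CB; split=> // -[i _ Biy]; apply: nB; exists i.
Qed.

Lemma correspondence_ae A B A' B' : r A B -> r A' B' ->
  {ae mu1, forall x, A x <-> A' x} -> {ae mu2, forall y, B y <-> B' y}.
Proof.
have [rm r1 r2 rI] := rP.
suff sub A0 B0 A1 B1 : r A0 B0 -> r A1 B1 ->
    {ae mu1, forall x, A0 x -> A1 x} -> {ae mu2, forall y, ~ (B0 `\` B1) y}.
  move=> rAB rAB' AA'.
  have /(sub _ _ _ _ rAB rAB') BB' : {ae mu1, forall x, A x -> A' x}.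
    by apply: filterS AA' => x [].
  have /(sub _ _ _ _ rAB' rAB) B'B : {ae mu1, forall x, A' x -> A x}.
    by apply: filterS AA' => x [].
  apply: filterS2 BB' B'B => y BB' B'B.
  by split=> h; apply: contrapT => nh; [exact: BB'|exact: B'B].
move=> rAB rAB' AA'.
have [[mA mB] [mA' mB']] := (rm _ _ rAB, rm _ _ rAB').
apply: ae_not_in_by_correspondence; first exact: measurableD.
move=> P rPQ.
have PA := correspondence_sub rAB rPQ (fun y h => h.1).
have PA' := correspondence_disjoint rAB' rPQ (fun y h => h.2).
apply: filterS3 PA PA' AA' => x PA PA' AA' Px.
by apply: (PA' Px); exact/AA'/PA.
Qed.

(** A point y is sent to the infimum of the rationals q such that y lies in a
  set corresponding to the sublevel set of f at q. Values in the extended reals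
  make the sublevel sets of this infimum exact unions, with no exceptional
  set. *)
Lemma correspondence_function (f : T1 -> R) : measurable_fun setT f ->
  exists2 h : T2 -> R, measurable_fun setT h &
    forall D B, measurable D -> r (f @^-1` D) B ->
      {ae mu2, forall y, B y <-> D (h y)}.
Proof.
have [rm r1 r2 rI] := rP => mf.
have mfD D : measurable D -> measurable (f @^-1` D).
  by move=> mD; rewrite -[X in measurable X]setTI; exact: mf.
have /choice[B rB] : forall q : rat, exists B, r (f @^-1` `]-oo, ratr q[) B.
  by move=> q; apply: r1; exact: mfD.
have mB q : measurable (B q) by have [] := rm _ _ (rB q).
pose c y : \bar R := ereal_inf [set (ratr q)%:E | q in [set q | B q y]].
have cray (t : R) y : (c y < t%:E)%E <->
    exists i : {q : rat | ratr q < t}, B (val i) y.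
  split=> [/ereal_inf_lt[_ [q Bqy <-]]|[[q /= qt] Bqy]].
    by rewrite lte_fin => qt; exists (exist _ q qt).
  rewrite (@le_lt_trans _ _ (ratr q)%:E) ?lte_fin//.
  by apply: ereal_inf_lbound; exists q.
have mc : measurable_fun setT c.
  apply: (measurability _ (ErealGenInftyO.measurableE R)) => _ [_ [t ->] <-].
  rewrite setTI (_ : _ @^-1` _ =
      \bigcup_(q : rat) (if ratr q < t then B q else set0)).
    by apply: bigcupT_measurable_rat => q; case: ifP.
  apply/seteqP; split=> y; rewrite /preimage/= in_itv/=.
    by move/cray => [[q /= qt] Bqy]; exists q => //=; rewrite qt.
  by move=> [q _]; case: ifP => // qt Bqy; apply/cray; exists (exist _ q qt).
(* Correspondences respect complements and countable unions mod 0, and so do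
  preimages; hence it suffices to treat the rays. *)
pose good (D : set \bar R) := measurable D /\
  forall C, r ((EFin \o f) @^-1` D) C -> {ae mu2, forall y, C y <-> D (c y)}.
have mefD (D : set \bar R) : measurable D -> measurable ((EFin \o f) @^-1` D).
  move=> mD; rewrite -[X in measurable X]setTI.
  have mef : measurable_fun setT (EFin \o f) by exact/measurable_EFinP.
  exact: mef.
have good_sigma : sigma_algebra setT good.
  split.
  - split=> // C rC; rewrite preimage_set0 in rC.
    have mC : measurable C by have [] := rm _ _ rC.
    have := correspondence_measure rC; rewrite measure0 => /esym.
    by move=> /(ae_not_in mC); apply: filterS => y nCy; split.
  - move=> D [mD gD]; rewrite setTD; split; first exact: measurableC.
    move=> C; rewrite preimage_setC => rC.
    have [C' rC'] := r1 _ (mefD _ mD).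
    apply: filterS2 (correspondence_setC rC' rC) (gD _ rC') => y CC' C'D.
    by rewrite CC' C'D.
  - move=> D gD; split.
      by apply: bigcupT_measurable => n; exact: (gD n).1.
    move=> C; rewrite preimage_bigcup => rC.
    have /choice[C' rC'] : forall n, exists C', r ((EFin \o f) @^-1` D n) C'.
      by move=> n; apply: r1; exact/mefD/(gD n).1.
    have CD : {ae mu2, forall y, forall n, C' n y <-> D n (c y)}.
      by apply: ae_countable => n; apply: (gD n).2.
    apply: filterS2 (correspondence_bigcup rC' rC) CD => y -> CD.
    by split=> [[n /CD]|[n _ /CD]]; exists n.
have goodP D : measurable D -> good D.
  move=> mD; have {mD} : (@ErealGenInftyO.G R).-sigma.-measurable D.
    by rewrite -ErealGenInftyO.measurableE.
  move: D; apply: smallest_sub => // _ [t ->]; split.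
    exact: emeasurable_itv.
  move=> C rC.
  have rC' :
      r (\bigcup_(i : {q : rat | ratr q < t}) f @^-1` `]-oo, ratr (val i)[) C.
    rewrite (_ : \bigcup_i _ = (EFin \o f) @^-1` `]-oo, t%:E[)//.
    apply/seteqP; split=> x.
      move=> [[q qt] _]; rewrite /preimage/= !in_itv/= lte_fin => fq.
      exact: lt_trans qt.
    rewrite /preimage/= in_itv/= lte_fin => ft.
    have [q] := rat_in_itvoo ft; rewrite in_itv/= => /andP[fq qt].
    by exists (exist _ q qt) => //=; rewrite in_itv.
  apply: filterS (correspondence_bigcup (fun i => rB (val i)) rC') => y ->.
  by rewrite /= in_itv/= cray.
exists (fine \o c).
  by apply: measurableT_comp => //; exact: fine_measurable.
move=> D C mD rC.
have mfD' : measurable (fine @^-1` D : set \bar R).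
  rewrite -[X in measurable X]setTI.
  by apply: (@fine_measurable R setT) => //; exact: measurableT.
exact: (goodP _ mfD').2.
Qed.

End measure_algebra_correspondence_theory.

(** * Point realization in Lebesgue-Rokhlin spaces *)

Section lebesgue_rokhlin_coordinates.
Context d (R : realType) (T : measurableType d).
Variable mu : {measure set T -> \bar R}.

(** Here g inverts f mod 0. The last clause says that g is measurable off an
  exceptional set M which f avoids a.e.; both D and M are Borel, while the
  preimage of A under g is measurable for the completed measure. *)
Definition rokhlin_coordinate (f : T -> R) (g : R -> T) :=
  [/\ measurable_fun setT f, {ae mu, forall x, g (f x) = x}
    & forall A, measurable A -> exists D M,
      [/\ measurable D, measurable M, mu (f @^-1` M) = 0%E
        & forall t, ~ M t -> (A (g t) <-> D t)]].

Lemma lebesgue_rokhlin_coordinate : lebesgue_rokhlin mu ->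
  exists f g, rokhlin_coordinate f g.
Proof.
move=> [a [c [f0 [g [mpf mpg [gf _]]]]]].
have mid : measurable_fun setT (idfun : measurableTypeR R -> R).
  exact: measurable_id.
have [f mf f0f] := measure_preserving_version mpf mid.
exists f, g; split=> //.
  by apply: filterS2 gf f0f => x gfx /= <-.
move=> A mA; move/measure_preservingP: mpg => /(_ _ mA)[D [mD _]].
move=> /ae_in_measurable[M [mM M0 MA]]; exists D, M; split=> //.
by rewrite (measure_preserving_law mpf mid mf f0f mM).
Qed.

(** The hypothesis on A involves a null set depending on A. A coordinate
  reduces the conclusion to countably many A, the preimages of the rational
  rays. *)
Lemma ae_id_of_ae_sets (k : T -> T) : lebesgue_rokhlin mu ->
  (forall A, measurable A -> {ae mu, forall x, A (k x) <-> A x}) ->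
  {ae mu, forall x, k x = x}.
Proof.
move=> /lebesgue_rokhlin_coordinate[f [g [mf gf _]]] kA.
have [N [mN N0 gfN]] := ae_in_measurable gf.
have fk : {ae mu, forall x, forall q : rat, f (k x) < ratr q <-> f x < ratr q}.
  apply: ae_countable => q; apply: (kA [set x | f x < ratr q]).
  rewrite (_ : [set x | _] = setT `&` f @^-1` `]-oo, ratr q[).
    exact: mf.
  by rewrite setTI; apply/seteqP; split=> x /=; rewrite in_itv.
have aeN := ae_not_in mN N0.
apply: filterS3 (kA _ mN) fk aeN => x kN fkx Nx.
have {}kN : ~ N (k x) by rewrite kN.
rewrite -(gfN _ kN) -[RHS](gfN _ Nx); congr g; apply/eqP; rewrite eq_le !leNgt.
apply/andP; split; apply/negP => /rat_in_itvoo[q]; rewrite in_itv/= => /andP[].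
  by move=> /fkx h /(lt_trans h); rewrite ltxx.
by move=> /fkx h /(lt_trans h); rewrite ltxx.
Qed.

End lebesgue_rokhlin_coordinates.

Section point_realization.
Context d1 d2 (R : realType) (T1 : measurableType d1) (T2 : measurableType d2).
Variables (mu1 : {measure set T1 -> \bar R}) (mu2 : {measure set T2 -> \bar R}).
Variable r : set T1 -> set T2 -> Prop.
Hypothesis rP : measure_algebra_correspondence mu1 mu2 r.

Definition realizes (S : T2 -> T1) :=
  forall A B, r A B -> {ae mu2, forall y, A (S y) <-> B y}.

(** The coordinate f on T1, with inverse g, is transported to a measurable
  function h on T2, and the point map is g \o h. *)
Lemma correspondence_realized : lebesgue_rokhlin mu1 ->
  exists S, realizes S.
Proof.
have [rm r1 r2 rI] := rP.
move=> /lebesgue_rokhlin_coordinate[f [g [mf gf gA]]].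
have [h mh hP] := correspondence_function rP mf.
have mfD D : measurable D -> measurable (f @^-1` D).
  by move=> mD; rewrite -[X in measurable X]setTI; exact: mf.
exists (g \o h) => A B rAB.
have [mA mB] := rm _ _ rAB.
have [D [M [mD mM M0 MA]]] := gA _ mA.
have [N rN] := r1 _ (mfD _ mM); have [C rC] := r1 _ (mfD _ mD).
have mN : measurable N by have [] := rm _ _ rN.
have N0 : {ae mu2, forall y, ~ N y}.
  by apply: ae_not_in => //; rewrite -(correspondence_measure rP rN).
have BC : {ae mu2, forall y, C y <-> B y}.
  apply: (correspondence_ae rP rC rAB).
  apply: filterS2 gf (ae_not_in (mfD _ mM) M0) => x gfx Mfx.
  by rewrite -{2}gfx MA.
have CD : {ae mu2, forall y, C y <-> D (h y)} by exact: hP.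
have hM : {ae mu2, forall y, ~ M (h y)}.
  by apply: filterS2 N0 (hP _ _ mM rN) => y nN <-.
by apply: filterS3 hM BC CD => y Mhy <- ->; exact: MA.
Qed.

Lemma realizes_measure_preserving S : realizes S ->
  measure_preserving mu2 mu1 S.
Proof.
have [rm r1 r2 rI] := rP => rS; apply/measure_preservingP => A mA.
have [B rAB] := r1 _ mA; exists B; split; last exact: rS.
  by have [] := rm _ _ rAB.
by rewrite (correspondence_measure rP rAB).
Qed.

End point_realization.

Lemma correspondence_isomorphism d1 d2 (R : realType)
    (T1 : measurableType d1) (T2 : measurableType d2)
    (mu1 : {measure set T1 -> \bar R}) (mu2 : {measure set T2 -> \bar R})
    (r : set T1 -> set T2 -> Prop) :
  measure_algebra_correspondence mu1 mu2 r ->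
  lebesgue_rokhlin mu1 -> lebesgue_rokhlin mu2 ->
  exists T S, measure_isomorphism mu1 mu2 T S /\ realizes mu2 r S.
Proof.
move=> rP lr1 lr2; have rP' := measure_algebra_correspondence_sym rP.
have [S rS] := correspondence_realized rP lr1.
have [T rT] := correspondence_realized rP' lr2.
have mpS := realizes_measure_preserving rP rS.
have mpT := realizes_measure_preserving rP' rT.
have [rm r1 r2 _] := rP.
exists T, S; split=> //; split=> //; split; apply: ae_id_of_ae_sets => //.
  move=> A mA; have [B rAB] := r1 _ mA.
  have ST := measure_preserving_ae mpT (rS _ _ rAB).
  by apply: filterS2 ST (rT _ _ rAB) => x ->.
move=> B mB; have [A rAB] := r2 _ mB.
have TS := measure_preserving_ae mpS (rT _ _ rAB).
by apply: filterS2 TS (rS _ _ rAB) => y ->.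
Qed.

(** * Operators preserving the characteristic functional *)

Section indicator_classes.
Context d (R : realType) (T : measurableType d).
Variable mu : probability T R.

Lemma class_indic A : measurable A ->
  exists F : LspaceType2 mu, {ae mu, forall x, F x = \1_A x}.
Proof.
move=> mA; apply: class_exists; first exact: measurable_indic.
apply/finite_norm2P.
rewrite (eq_integral (fun x => (\1_A x)%:E)) ?integral_indic// ?setIT.
  exact: le_lt_trans (probability_le1 mu mA) (ltry 1).
by move=> x _; rewrite indicE; case: (x \in A); rewrite ?expr1n ?expr0n.
Qed.

Lemma ae_eq_Rintegral (f g : T -> R) : measurable_fun setT f ->
  measurable_fun setT g -> {ae mu, forall x, f x = g x} ->
  \int[mu]_x f x = \int[mu]_x g x.
Proof.
move=> mf mg fg; congr fine; apply: ae_eq_integral => //.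
- exact/measurable_EFinP.
- exact/measurable_EFinP.
- by apply: filterS fg => x ->.
Qed.

Lemma zero_one_indic (f : T -> R) : measurable_fun setT f ->
  {ae mu, forall x, f x = 0 \/ f x = 1} ->
  exists2 A, measurable A & {ae mu, forall x, f x = \1_A x}.
Proof.
move=> mf f01; exists (f @^-1` [set 1]).
  by rewrite -[X in measurable X]setTI; exact: mf.
apply: filterS f01 => x [fx|fx]; rewrite indicE fx.
  by rewrite memNset//= fx => /esym/eqP; rewrite oner_eq0.
by rewrite mem_set.
Qed.

Lemma class_integral_set (F G : LspaceType2 mu) B : measurable B ->
  {ae mu, forall x, G x = \1_B x} ->
  (\int[mu]_(x in B) (F x)%:E = \int[mu]_x (F x * G x)%:E)%E.
Proof.
move=> mB GB; rewrite integral_mkcond; apply: ae_eq_integral => //.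
- apply/(measurable_restrictT _ mB)/measurable_funTS/measurable_EFinP.
  exact: class_measurable.
- by apply/measurable_EFinP/measurable_funM; exact: class_measurable.
- by apply: filterS GB => x -> _; rewrite epatch_indic.
Qed.

End indicator_classes.

Section characteristic_functionals.
Context d1 d2 (R : realType) (T1 : measurableType d1) (T2 : measurableType d2).
Variables (mu1 : probability T1 R) (mu2 : probability T2 R).
Variable U : LspaceType2 mu1 -> LspaceType2 mu2.
Hypothesis unitU : unitary U.
Hypothesis charU : preserves_characteristic_functional U.

Lemma unitary_scale (a : R) (F : LspaceType2 mu1) :
  exists2 G : LspaceType2 mu1, {ae mu1, forall x, G x = a * F x} &
    {ae mu2, forall y, U G y = a * U F y}.
Proof.
have [lin _ _] := unitU.
(* Linearity is stated for combinations a F + G, so a F is written as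
  (a - 1) F + F. *)
have [G GF] := class_lin (a - 1) F F.
exists G; first by apply: filterS GF => x ->; ring.
by apply: filterS (lin _ _ _ _ GF) => y ->; ring.
Qed.

Lemma characteristic_cos_sin (a : R) F :
  \int[mu2]_y cos (a * U F y) = \int[mu1]_x cos (a * F x) /\
  \int[mu2]_y sin (a * U F y) = \int[mu1]_x sin (a * F x).
Proof.
have [G GF UGF] := unitary_scale a F.
have aemphi d (T : measurableType d) (mu : probability T R)
    (phi : R -> R) (H K : LspaceType2 mu) : continuous phi ->
    {ae mu, forall x, H x = a * K x} ->
    \int[mu]_x phi (H x) = \int[mu]_x phi (a * K x).
  move=> /continuous_measurable_fun mphi HK; apply: ae_eq_Rintegral.
  - by apply: (measurableT_comp mphi); exact: class_measurable.
  - apply: (measurableT_comp mphi); apply: measurable_funM => //.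
    exact: class_measurable.
  - by apply: filterS HK => x ->.
rewrite -!(aemphi _ _ _ _ _ _ (@continuous_cos R) GF).
rewrite -!(aemphi _ _ _ _ _ _ (@continuous_cos R) UGF).
rewrite -!(aemphi _ _ _ _ _ _ (@continuous_sin R) GF).
rewrite -!(aemphi _ _ _ _ _ _ (@continuous_sin R) UGF).
have := charU G.
by rewrite /characteristic_functional /complex_integral /= => -[].
Qed.

Definition indicator_correspondence (A : set T1) (B : set T2) :=
  [/\ measurable A, measurable B & exists F : LspaceType2 mu1,
    {ae mu1, forall x, F x = \1_A x} /\ {ae mu2, forall y, U F y = \1_B y}].

(** [zero_one_valued] is applied to U F and F in one direction, and in the
  other to F and U F, where F is a preimage of the given indicator under U. *)
Lemma indicator_measure_algebra_correspondence :
  measure_algebra_correspondence mu1 mu2 indicator_correspondence.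
Proof.
have [_ _ surjU] := unitU.
have indic01 d (T : measurableType d) (mu : probability T R)
    (f : T -> R) A : {ae mu, forall x, f x = \1_A x} ->
    {ae mu, forall x, f x = 0 \/ f x = 1}.
  by apply: filterS => x ->; rewrite indicE; case: (_ \in _); [right|left].
split.
- by move=> A B [].
- move=> A mA; have [F FA] := class_indic mu1 mA.
  have [||B mB UFB] := @zero_one_indic _ _ _ mu2 (U F).
  + exact: class_measurable.
  + apply: (@zero_one_valued _ _ _ _ _ mu2 mu1 (U F) F).
    * exact: class_measurable.
    * exact: class_measurable.
    * exact: class_sqr_integrable.
    * exact: class_sqr_integrable.
    * exact: unitary_sqr.
    * exact: (characteristic_cos_sin _ _).1.
    * exact: (characteristic_cos_sin _ _).2.
    * exact: indic01 FA.
  by exists B; split=> //; exists F.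
- move=> B mB; have [G GB] := class_indic mu2 mB; have [F UFG] := surjU G.
  rewrite -UFG in GB.
  have [||A mA FA] := @zero_one_indic _ _ _ mu1 F.
  + exact: class_measurable.
  + apply: (@zero_one_valued _ _ _ _ _ mu1 mu2 F (U F)).
    * exact: class_measurable.
    * exact: class_measurable.
    * exact: class_sqr_integrable.
    * exact: class_sqr_integrable.
    * by rewrite unitary_sqr.
    * by rewrite (characteristic_cos_sin _ _).1.
    * by rewrite (characteristic_cos_sin _ _).2.
    * exact: indic01 GB.
  by exists A; split=> //; exists F.
- move=> A B A' B' [mA mB [F [FA UFB]]] [mA' mB' [F' [FA' UFB']]].
  have inner d (T : measurableType d) (mu : probability T R)
      (G G' : LspaceType2 mu) C C' : measurable C -> measurable C' ->
      {ae mu, forall x, G x = \1_C x} -> {ae mu, forall x, G' x = \1_C' x} ->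
      (\int[mu]_x (G x * G' x)%:E = mu (C `&` C'))%E.
    move=> mC mC' GC GC'; have mCC' := measurableI _ _ mC mC'.
    rewrite -[C `&` C']setIT -integral_indic//.
    apply: ae_eq_integral => //.
    + by apply/measurable_EFinP/measurable_funM; exact: class_measurable.
    + by apply/measurable_EFinP/measurable_indic; exact: measurableI.
    + by apply: filterS2 GC GC' => x -> -> _; rewrite indicI.
  transitivity (\int[mu1]_x (F x * F' x)%:E)%E; first exact/esym/inner.
  transitivity (\int[mu2]_y (U F y * U F' y)%:E)%E; last exact: inner.
  rewrite -[LHS]fineK; last first.
    exact/integrable_fin_num/class_mul_integrable.
  rewrite -[RHS]fineK; last first.
    exact/integrable_fin_num/class_mul_integrable.
  by congr EFin; exact/esym/unitary_inner.
Qed.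

(** An indicator of a set B on T2 is U G for the indicator G of a corresponding
  set A, and is also G \o S a.e. Hence U F and F \o S have the same integral
  over B, namely the inner product of F and G. *)
Lemma realization_induces S : realizes mu2 indicator_correspondence S ->
  forall F, {ae mu2, forall y, U F y = F (S y)}.
Proof.
have rP := indicator_measure_algebra_correspondence.
move=> rS F; have mpS := realizes_measure_preserving rP rS.
have [k mk Fk] := measure_preserving_version mpS (class_measurable F).
have : ae_eq mu2 setT (EFin \o U F) (EFin \o k).
  apply: integral_ae_eq => //.
  - apply/Lfun1_integrable/Lfun_subset12; last exact: class_Lfun.
    by rewrite fin_num_measure.
  - exact/measurable_EFinP.
  move=> B _ mB; have [_ _ /(_ B mB)[A rAB] _] := rP.
  have [mA _ [G [GA UGB]]] := rAB.
  rewrite (class_integral_set _ mB UGB).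
  have -> : (\int[mu2]_y (U F y * U G y)%:E = \int[mu1]_x (F x * G x)%:E)%E.
    rewrite -[LHS]fineK; last first.
      exact/integrable_fin_num/class_mul_integrable.
    rewrite -[RHS]fineK; last first.
      exact/integrable_fin_num/class_mul_integrable.
    by congr EFin; exact: unitary_inner.
  rewrite -(class_integral_set F mA GA) [LHS]integral_mkcond.
  rewrite [RHS]integral_mkcond !restrict_EFin !patch_indic.
  have mFA : measurable_fun setT (F \* \1_A)%R.
    apply: measurable_funM; [exact: class_measurable|exact: measurable_indic].
  have mkB : measurable_fun setT (k \* \1_B)%R.
    by apply: measurable_funM => //; exact: measurable_indic.
  apply: (@same_law_integral _ _ _ _ _ _ _
    (F \* \1_A)%R (k \* \1_B)%R EFin) => //.
  move=> C mC; apply/esym; apply: (measure_preserving_law mpS mFA mkB) => //.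
  apply: filterS2 Fk (rS _ _ rAB) => y /= -> AB.
  rewrite !indicE; congr (_ * (nat_of_bool _)%:R).
  by apply/idP/idP => /set_mem h; apply/mem_set; exact/AB.
by apply: filterS2 Fk => y -> /(_ I)[].
Qed.

Lemma characteristic_multiplicative :
  lebesgue_rokhlin mu1 -> lebesgue_rokhlin mu2 -> multiplicative U.
Proof.
move=> lr1 lr2.
have [T [S [iTS rS]]] := correspondence_isomorphism
  indicator_measure_algebra_correspondence lr1 lr2.
by exists T, S; split=> //; exact: realization_induces.
Qed.

End characteristic_functionals.

Lemma multiplicative_characteristic d1 d2 (R : realType)
    (T1 : measurableType d1) (T2 : measurableType d2)
    (mu1 : probability T1 R) (mu2 : probability T2 R)
    (U : LspaceType2 mu1 -> LspaceType2 mu2) :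
  multiplicative U -> preserves_characteristic_functional U.
Proof.
move=> [T [S [[_ mpS _] US]]] F.
have FS : {ae mu2, forall y, F (S y) = U F y} by apply: filterS (US F) => y ->.
rewrite /characteristic_functional /complex_integral /=.
have integralS (phi : R -> R) : continuous phi ->
    \int[mu2]_y phi (U F y) = \int[mu1]_x phi (F x).
  move=> /continuous_measurable_fun mphi.
  by apply: measure_preserving_integral mpS _ _ FS mphi; exact: class_measurable.
by rewrite (integralS _ (@continuous_cos R)) (integralS _ (@continuous_sin R)).
Qed.

(** * Linearity mod 0 and countable separation *)

Section linear_mod0_theory.
Context (R : realType) (E : lmodType R) (H : forall n, set (E -> 'rV[R]_n)).
Variable mu : probability (cylindrical H) R.

Lemma linear_mod0_ae (F : lmodType R) (f f' : cylindrical H -> F) :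
  {ae mu, forall x, f x = f' x} -> linear_mod0 mu f -> linear_mod0 mu f'.
Proof.
move=> ff' [V [g [subV nV gV fg]]]; exists V, g; split=> //.
by apply: filterS2 ff' fg => x <-.
Qed.

Lemma subspace_linear0 (F : lmodType R) (V : set (cylindrical H))
    (g : cylindrical H -> F) : submod_closed (mem V) ->
  (forall a x y, V x -> V y -> g (a *: x + y) = a *: g x + g y) -> g 0 = 0.
Proof.
move=> [/set_mem V0 _] /(_ 1 0 0 V0 V0); rewrite !scale1r addr0 => /eqP.
by rewrite -subr_eq0 opprD addNKr oppr_eq0 => /eqP.
Qed.

Definition coordinate_functional : set (E -> R) :=
  [set phi | exists n (h : E -> 'rV[R]_n) (i : 'I_n),
    H h /\ phi = (fun x => h x ord0 i)].

Definition determined_by (phi : nat -> E -> R) (A : set E) :=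
  forall x y, (forall k, phi k x = phi k y) -> A x -> A y.

Section vector_measure_space_theory.
Hypothesis vms : vector_measure_space mu.

Lemma coordinate_functional_linear phi a x y : coordinate_functional phi ->
  phi (a *: x + y) = a * phi x + phi y.
Proof.
have [lin _ _ _] := vms => -[n [h [i [Hh ->]]]].
by rewrite (lin _ _ Hh) !mxE.
Qed.

Lemma coordinate_functional_measurable phi : coordinate_functional phi ->
  measurable_fun setT (phi : cylindrical H -> R).
Proof.
move=> [n [h [i [Hh ->]]]].
apply: (measurability _ (RGenOpens.measurableE R)) => _ [_ [a [b ->]] <-].
rewrite setTI; apply: sub_sigma_algebra; exists n => //; exists h => //.
exists ((fun v : 'rV[R]_n => v ord0 i) @^-1` `]a, b[%classic); last first.
  by rewrite setTI.
apply: sub_sigma_algebra.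
have /continuousP : continuous (fun v : 'rV[R]_n => v ord0 i).
  exact: coord_continuous.
by apply; exact: interval_open.
Qed.

Lemma coordinate_functional0 : coordinate_functional (fun=> 0).
Proof.
have [_ /(_ 1%N)[/set_mem H0 _] _ _] := vms.
exists 1%N, 0, ord0; split=> //.
by apply/funext => x; rewrite mxE.
Qed.

Lemma determined_by_countable (I : countType) (A : I -> set E) :
  (forall i, exists2 phi : nat -> E -> R,
    forall k, coordinate_functional (phi k) & determined_by phi (A i)) ->
  exists2 phi : nat -> E -> R, forall k, coordinate_functional (phi k) &
    forall i, determined_by phi (A i).
Proof.
move=> dA.
have /choice[phi phiP] : forall i, exists phi : nat -> E -> R,
    (forall k, coordinate_functional (phi k)) /\ determined_by phi (A i).
  by move=> i; have [phi] := dA i; exists phi.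
exists (fun n => if @unpickle (I * nat)%type n is Some ik
  then phi ik.1 ik.2 else fun=> 0).
  move=> n; case: unpickle => [[i k]|]; first exact: (phiP i).1.
  exact: coordinate_functional0.
move=> i x y xy; apply: (phiP i).2 => k.
by have := xy (pickle (i, k)); rewrite pickleK.
Qed.

(** The sets determined by countably many functionals form a sigma-algebra, and
  it contains the cylinders. *)
Lemma measurable_determined_by (A : set (cylindrical H)) : measurable A ->
  exists2 phi : nat -> E -> R, forall k, coordinate_functional (phi k) &
    determined_by phi A.
Proof.
pose det (A : set E) := exists2 phi : nat -> E -> R,
  forall k, coordinate_functional (phi k) & determined_by phi A.
rewrite -/(det A); move: A; apply: smallest_sub.
  split.
  - by exists (fun _ _ => 0) => // k; exact: coordinate_functional0.
  - move=> A [phi phiF phiA]; exists phi => // x y xy [_ Ax]; split=> // Ay.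
    by apply: Ax; apply: phiA Ay => k; rewrite xy.
  - move=> A /determined_by_countable[phi phiF phiA]; exists phi => //.
    by move=> x y xy [i _ Ax]; exists i => //; exact: phiA Ax.
move=> _ [n _ [h Hh [B _ <-]]]; rewrite setTI.
(* The n coordinates of h, padded by the zero functional. *)
exists (fun k x => if insub k is Some i then h x ord0 i else 0).
  move=> k; case: insubP => [i _ _|_]; last exact: coordinate_functional0.
  by exists n, h, i.
move=> x y xy; rewrite /preimage/= (_ : h y = h x)//.
by apply/rowP => i; have := xy (val i); rewrite valK.
Qed.

(** A coordinate f of the Rokhlin space is injective off a null set N, and both
  f and N depend on countably many functionals only. If these all vanish at z,
  then translating a point x of the complement of N by z keeps it there and
  does not change f, so that x + z = x. *)
Lemma countably_separated :
  exists2 phi : nat -> E -> R, forall k, coordinate_functional (phi k) &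
    forall z : E, (forall k, phi k z = 0) -> z = 0.
Proof.
have [_ _ _ /lebesgue_rokhlin_coordinate[f [g [mf gf _]]]] := vms.
have [N [mN N0 gfN]] := ae_in_measurable gf.
have [|phi phiF phiA] := @determined_by_countable (option rat)
  (fun o => if o is Some q then f @^-1` `]-oo, ratr q[ else ~` N).
  move=> [q|]; apply: measurable_determined_by.
    by rewrite -[X in measurable X]setTI; exact: mf.
  exact: measurableC.
exists phi => // z phiz.
have [x Nx] : exists x, ~ N x.
  apply: contrapT => allN; have : mu N = 1%E.
    rewrite -(probability_setT mu); congr (mu _); apply/seteqP; split=> // x _.
    by apply: contrapT => Nx; apply: allN; exists x.
  by rewrite N0 => /esym/eqP; rewrite onee_eq0.
have phix k : phi k (z + x) = phi k x.
  have := coordinate_functional_linear 1 z x (phiF k).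
  by rewrite phiz mulr0 add0r scale1r.
have Nzx : ~ N (z + x).
  by apply: (phiA None x) => // k; rewrite phix.
have fzx : f (z + x) = f x.
  apply/eqP; rewrite eq_le !leNgt; apply/andP.
  split; apply/negP => /rat_in_itvoo[q]; rewrite in_itv/= => /andP[fq qf].
    have := phiA (Some q) x (z + x) (fun k => esym (phix k)).
    by rewrite /preimage/= !in_itv/= => /(_ fq) /(lt_trans qf); rewrite ltxx.
  have := phiA (Some q) (z + x) x phix.
  by rewrite /preimage/= !in_itv/= => /(_ fq) /(lt_trans qf); rewrite ltxx.
by apply/(addIr x); rewrite add0r -(gfN _ Nzx) fzx gfN.
Qed.

End vector_measure_space_theory.
End linear_mod0_theory.

Section linear_mod0_maps.
Context (R : realType) (E1 E2 : lmodType R).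
Context (H1 : forall n, set (E1 -> 'rV[R]_n)).
Context (H2 : forall n, set (E2 -> 'rV[R]_n)).
Variables (mu1 : probability (cylindrical H1) R).
Variables (mu2 : probability (cylindrical H2) R).

(** A countable separating family phi of functionals embeds E2 linearly into a
  space of sequences. Let g k be a linear version of phi k \o T. On the
  subspace W of the points where the sequence g lies in the image of this
  embedding, lifting g to E2 gives a linear map L; almost every x lies in W,
  with T x as lift. *)
Lemma linear_mod0_coordinates (T : cylindrical H1 -> cylindrical H2) :
  vector_measure_space mu2 ->
  (forall phi, coordinate_functional H2 phi ->
    linear_mod0 (F := R^o) mu1 (phi \o T)) ->
  linear_mod0 mu1 T.
Proof.
move=> vms2 linT; have [phi phiF sep] := countably_separated vms2.
have phi_lin k a x y : phi k (a *: x + y) = a * phi k x + phi k y.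
  exact: (coordinate_functional_linear vms2).
have phi_inj y y' : (forall k, phi k y = phi k y') -> y = y'.
  move=> yy'; apply/eqP; rewrite -subr_eq0; apply/eqP/sep => k.
  by rewrite -scaleN1r addrC phi_lin yy' mulN1r addNr.
have /choice[V /choice[g gP]] : forall k, exists (V : set (cylindrical H1)),
    exists g : cylindrical H1 -> R^o,
    [/\ submod_closed (mem V), mu1.-negligible (~` V),
      forall a x y, V x -> V y -> g (a *: x + y) = a *: g x + g y
    & {ae mu1, forall x, phi k (T x) = g x}].
  by move=> k; exact: linT.
pose W : set (cylindrical H1) := [set x | (forall k, V k x) /\
  exists y : cylindrical H2, forall k, phi k y = g k x].
pose L x : cylindrical H2 := xget 0 [set y | forall k, phi k y = g k x].
have LP x : W x -> forall k, phi k (L x) = g k x.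
  by move=> [_ [y yP]]; exact: (@xgetI _ 0 [set y | forall k, phi k y = g k x] y).
have VP : {ae mu1, forall x, forall k, V k x}.
  by apply: ae_countable => k; have [_ + _ _] := gP k.
have gT : {ae mu1, forall x, forall k, phi k (T x) = g k x}.
  by apply: ae_countable => k; have [_ _ _] := gP k.
have WP : {ae mu1, forall x, W x}.
  by apply: filterS2 VP gT => x Vx Tx; split=> //; exists (T x).
exists W, L; split=> //.
- split.
    apply/mem_set; split=> [k|]; first by have [[/set_mem]] := gP k.
    exists 0 => k; have [subV _ lin _] := gP k.
    rewrite (subspace_linear0 subV lin).
    have := phi_lin k 1 0 0; rewrite scale1r addr0 mul1r => /eqP.
    by rewrite -subr_eq0 opprD addNKr oppr_eq0 => /eqP.
  move=> a x x' /set_mem[Vx [y yP]] /set_mem[Vx' [y' y'P]].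
  apply/mem_set; split=> [k|].
    have [[_ subV] _ _ _] := gP k.
    by apply/set_mem/subV; apply/mem_set.
  exists (a *: y + y') => k; have [_ _ lin _] := gP k.
  by rewrite lin// phi_lin yP y'P.
- move=> a x x' Wx Wx'; apply: phi_inj => k; rewrite phi_lin !LP//.
    by have [_ _ lin _] := gP k; apply: lin; [case: Wx|case: Wx'].
  split=> [j|].
    have [[_ subV] _ _ _] := gP j.
    by apply/set_mem/subV; apply/mem_set; [case: Wx|case: Wx'].
  exists (a *: L x + L x') => j; rewrite phi_lin !LP//.
  by have [_ _ lin _] := gP j; rewrite lin//; [case: Wx|case: Wx'].
- apply: filterS2 WP gT => x Wx Tx; apply: phi_inj => k.
  by rewrite LP.
Qed.

Lemma linear_mod0_comp (F : lmodType R) (f : cylindrical H1 -> F)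
    (S : cylindrical H2 -> cylindrical H1) :
  measure_preserving mu2 mu1 S -> linear_mod0 mu1 f -> linear_mod0 mu2 S ->
  linear_mod0 mu2 (f \o S).
Proof.
move=> mpS [V [g [[V0 subV] nV ling fg]]] [W [L [[W0 subW] nW linL SL]]].
exists [set y | W y /\ V (L y)], (g \o L); split.
- split.
    apply/mem_set; split; first exact/set_mem.
    by rewrite (subspace_linear0 (conj W0 subW) linL); apply/set_mem.
  move=> a y y' /set_mem[Wy Vy] /set_mem[Wy' Vy']; apply/mem_set; split.
    by apply/set_mem/subW; apply/mem_set.
  by rewrite linL//; apply/set_mem/subV; apply/mem_set.
- have VS := measure_preserving_ae mpS (nV : {ae mu1, forall x, V x}).
  have : {ae mu2, forall y, W y /\ V (L y)}.
    by apply: filterS3 VS SL (nW : {ae mu2, forall y, W y}) => y VSy <-.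
  exact.
- move=> a y y' [Wy Vy] [Wy' Vy'] /=; rewrite linL//; exact: ling.
- by apply: filterS2 (measure_preserving_ae mpS fg) SL => y /= -> ->.
Qed.

End linear_mod0_maps.

(** * Isomorphisms of vector measure spaces *)

Lemma measure_isomorphism_unitary d1 d2 (R : realType)
    (T1 : measurableType d1) (T2 : measurableType d2)
    (mu1 : {measure set T1 -> \bar R}) (mu2 : {measure set T2 -> \bar R}) T S :
  measure_isomorphism mu1 mu2 T S ->
  exists2 U : LspaceType2 mu1 -> LspaceType2 mu2, unitary U & induced_by U T S.
Proof.
move=> iTS; have [mpT mpS [ST TS]] := iTS.
have msqr : measurable_fun setT (fun t : R => (t ^+ 2)%:E).
  by apply/measurable_EFinP; exact: measurable_funX.
have comp d d' (X : measurableType d) (Y : measurableType d')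
    (mu : {measure set X -> \bar R}) (nu : {measure set Y -> \bar R})
    (k : Y -> X) (F : LspaceType2 mu) : measure_preserving nu mu k ->
    exists G : LspaceType2 nu, {ae nu, forall y, G y = F (k y)}.
  move=> mpk; have mF := class_measurable F.
  have [f mf Ff] := measure_preserving_version mpk mF.
  have f2 : finite_norm nu 2 f.
    apply/finite_norm2P.
    rewrite (@same_law_integral _ _ _ _ _ nu mu f F _ mf mF msqr).
      by apply/finite_norm2P; exact: Lebesgue_finite.
    by move=> B mB; exact: (measure_preserving_law mpk mF mf Ff mB).
  have [G Gf] := class_exists mf f2; exists G.
  by apply: filterS2 Gf Ff => y -> ->.
have /choice[U US] : forall F : LspaceType2 mu1, exists G : LspaceType2 mu2,
    {ae mu2, forall y, G y = F (S y)}.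
  by move=> F; exact: (comp _ _ _ _ _ _ _ F mpS).
exists U => //; split.
- move=> a f g h hfg.
  have USh : {ae mu2, forall y, U h y = a * f (S y) + g (S y)}.
    by apply: filterS2 (US h) (measure_preserving_ae mpS hfg) => y -> ->.
  by apply: filterS3 (US f) (US g) USh => y -> -> ->.
- move=> F; rewrite !Lnorm2E.
  rewrite (@same_law_integral _ _ _ _ _ mu2 mu1 (U F) F _ _ _ msqr)//.
  + exact: class_measurable.
  + exact: class_measurable.
  move=> B mB; apply: (measure_preserving_law mpS) => //.
  + exact: class_measurable.
  + exact: class_measurable.
  + by apply: filterS (US F) => y ->.
- move=> G; have [F FG] := comp _ _ _ _ _ _ _ G mpT; exists F.
  apply: class_ext.
  by apply: filterS3 (US F) (measure_preserving_ae mpS FG) TS => y -> -> ->.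
Qed.

Lemma coordinate_functional_class (R : realType) (E : lmodType R)
    (H : forall n, set (E -> 'rV[R]_n)) (mu : probability (cylindrical H) R)
    (phi : E -> R) :
  vector_measure_space mu -> square_integrable mu ->
  coordinate_functional H phi ->
  exists2 F : LspaceType2 mu, LinL2 mu F & {ae mu, forall x, F x = phi x}.
Proof.
move=> vms sq phiF.
have [f fphi] := mfun_class_exists mu (coordinate_functional_measurable phiF).
have linf : Lin mu f.
  exists setT, (phi : cylindrical H -> R^o); split=> //.
  - by split=> [|a x y _ _]; rewrite in_setT.
  - by rewrite setCT; exact: negligible_set0.
  - by move=> a x y _ _; exact: (coordinate_functional_linear vms).
have [F Ff] := class_of_mfun (sq _ linf).
by exists F; rewrite /LinL2/= Ff.
Qed.

Section vector_isomorphisms.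
Context (R : realType) (E1 E2 : lmodType R).
Context (H1 : forall n, set (E1 -> 'rV[R]_n)).
Context (H2 : forall n, set (E2 -> 'rV[R]_n)).
Variables (mu1 : probability (cylindrical H1) R).
Variables (mu2 : probability (cylindrical H2) R).

Section induced.
Variable U : LspaceType2 mu1 -> LspaceType2 mu2.
Variables (T : cylindrical H1 -> cylindrical H2)
  (S : cylindrical H2 -> cylindrical H1).
Hypothesis indU : induced_by U T S.

(** A functional phi on E2 is U F for some F linear mod 0, so that
  phi \o T = F \o S \o T = F; a functional phi on E1 has phi \o S = U phi. *)
Lemma induced_vector_isomorphism :
  vector_measure_space mu1 -> vector_measure_space mu2 ->
  square_integrable mu1 -> square_integrable mu2 ->
  U @` LinL2 mu1 = LinL2 mu2 -> vector_isomorphism mu1 mu2 T S.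
Proof.
move=> vms1 vms2 sq1 sq2 ULin.
have [[mpT mpS [ST TS]] US] := indU.
split=> //; split=> //.
- apply: (linear_mod0_coordinates vms2) => phi phiF.
  have [G linG Gphi] := coordinate_functional_class vms2 sq2 phiF.
  move: linG; rewrite -ULin => -[F linF UFG].
  apply: linear_mod0_ae linF.
  have FS : {ae mu2, forall y, F (S y) = phi y}.
    by apply: filterS2 (US F) Gphi => y; rewrite UFG => -> ->.
  by apply: filterS2 (measure_preserving_ae mpT FS) ST => x + STx; rewrite STx.
- apply: (linear_mod0_coordinates vms1) => phi phiF.
  have [F linF Fphi] := coordinate_functional_class vms1 sq1 phiF.
  have : LinL2 mu2 (U F) by rewrite -ULin; exists F.
  apply: linear_mod0_ae.
  by apply: filterS2 (US F) (measure_preserving_ae mpS Fphi) => y -> ->.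
Qed.

Lemma vector_isomorphism_Lin :
  unitary U -> vector_isomorphism mu1 mu2 T S -> U @` LinL2 mu1 = LinL2 mu2.
Proof.
move=> unitU; have [[mpT mpS [ST TS]] US] := indU; move=> [[_ linT] [_ linS] _].
have surjU G : exists2 F : LspaceType2 mu1, U F = G &
    {ae mu1, forall x, F x = G (T x)}.
  have [_ _ /(_ G)[F UFG]] := unitU; exists F => //.
  have FS : {ae mu2, forall y, F (S y) = G y}.
    by apply: filterS (US F) => y; rewrite UFG.
  by apply: filterS2 (measure_preserving_ae mpT FS) ST => x <- ->.
apply/seteqP; split=> [_ [F linF <-]|G linG].
  apply: linear_mod0_ae (linear_mod0_comp mpS linF linS).
  by apply: filterS (US F) => y ->.
have [F UFG FG] := surjU G; exists F => //.
apply: linear_mod0_ae (linear_mod0_comp mpT linG linT).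
by apply: filterS FG => x ->.
Qed.

End induced.
End vector_isomorphisms.

Theorem proposition1 (R : realType) (E1 E2 : lmodType R)
    (H1 : forall n, set (E1 -> 'rV[R]_n)) (H2 : forall n, set (E2 -> 'rV[R]_n))
    (mu1 : probability (cylindrical H1) R) (mu2 : probability (cylindrical H2) R)
    (vms1 : vector_measure_space mu1) (vms2 : vector_measure_space mu2)
    (sq1 : square_integrable mu1) (sq2 : square_integrable mu2) :
  [<-> exists T S, vector_isomorphism mu1 mu2 T S;
       exists U : LspaceType2 mu1 -> LspaceType2 mu2,
         [/\ unitary U, multiplicative U & U @` LinL2 mu1 = LinL2 mu2];
       exists U : LspaceType2 mu1 -> LspaceType2 mu2,
         [/\ unitary U, preserves_characteristic_functional U
           & U @` LinL2 mu1 = LinL2 mu2]]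
  /\
  forall U : LspaceType2 mu1 -> LspaceType2 mu2,
    unitary U -> U @` LinL2 mu1 = LinL2 mu2 ->
    multiplicative U \/ preserves_characteristic_functional U ->
    multiplicative U /\
    forall T S, induced_by U T S -> vector_isomorphism mu1 mu2 T S.
Proof.
have [_ _ _ lr1] := vms1; have [_ _ _ lr2] := vms2.
have multU (U : LspaceType2 mu1 -> LspaceType2 mu2) : unitary U ->
    preserves_characteristic_functional U -> multiplicative U.
  by move=> unitU charU; exact: characteristic_multiplicative.
split; last first.
  move=> U unitU ULin UP; split=> [|T S indU].
    by case: UP => // /multU; exact.
  exact: induced_vector_isomorphism indU vms1 vms2 sq1 sq2 ULin.
tfae.
- move=> [T [S iTS]].
  have [[mpT _] [mpS _] TS] := iTS.
  have [|U unitU indU] := @measure_isomorphism_unitary _ _ _ _ _ mu1 mu2 T S.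
    by split.
  exists U; split=> //; first by exists T, S.
  exact: vector_isomorphism_Lin indU unitU iTS.
- move=> [U [unitU mU ULin]]; exists U; split=> //.
  exact: multiplicative_characteristic.
- move=> [U [unitU charU ULin]].
  have [T [S indU]] := multU _ unitU charU; exists T, S.
  exact: induced_vector_isomorphism indU vms1 vms2 sq1 sq2 ULin.
Qed.
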